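(* Let $(\mathfrak h, J)$ be a Lie algebra equipped with a complex structure $J$. Let $\mathfrak g=\mathfrak k\oplus\mathfrak h$ (direct sum of vector spaces) be a Lie algebra such that $\mathfrak h$ is an ideal of $\mathfrak g$ and $\mathfrak k$ is a linear subspace, and let $[\cdot,\cdot]_{\mathfrak k}$, $\pi$, $\alpha$ be the data on $\mathfrak k$ arising from the exact sequence $0\to\mathfrak h\to\mathfrak g\to\mathfrak g/\mathfrak h\to 0$ and this splitting. Let $j:\mathfrak k\to\mathfrak k$ be an almost complex structure on $\mathfrak k$ (a linear map with $j^2=-1$), let $\beta\in \mathrm{Hom}(\mathfrak k,\mathfrak h)$ be a linear map, and define the linear map $\tilde J:\mathfrak g\to\mathfrak g$ by $$\tilde J x=Jx \ \text{ for } x\in\mathfrak h,\qquad \tilde J x=jx+\beta(x)\ \text{ for } x\in\mathfrak k.$$ Then $\tilde J$ defines a complex structure on $\mathfrak g$ if and only if the following four conditions hold: (1) $J\beta(x)=-\beta(j(x))$ for all $x\in\mathfrak k$; (2) $\pi(j(x))Jy+[\beta(x),Jy]_{\mathfrak h}=\pi(x)y+J\pi(j(x))y+J\pi(x)Jy+J[\beta(x),y]_{\mathfrak h}$ for all $x\in\mathfrak k$, $y\in\mathfrak h$; (3) $[j(x),j(y)]_{\mathfrak k}=[x,y]_{\mathfrak k}+j[j(x),y]_{\mathfrak k}+j[x,j(y)]_{\mathfrak k}$ for all $x,y\in\mathfrak k$; (4) for all $x,y\in\mathfrak k$, $$\alpha(j(x),j(y))-\alpha(x,y)-J\alpha(x,j(y))-J\alpha(j(x),y)$$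 $$=\beta([j(x),y]_{\mathfrak k})+\beta([x,j(y)]_{\mathfrak k})-[\beta(x),\beta(y)]_{\mathfrak h}+\pi(j(y))\beta(x)-\pi(j(x))\beta(y)-J\pi(y)\beta(x)+J\pi(x)\beta(y).$$
   Context: Lie algebras are real. A complex structure on a Lie algebra $\mathfrak g$ is a linear map $J:\mathfrak g\to\mathfrak g$ with $J^2=-1$ (almost complex structure) which is integrable: $[Jx,Jy]=[x,y]+J[Jx,y]+J[x,Jy]$ for all $x,y\in\mathfrak g$. Given a Lie algebra $\mathfrak g=\mathfrak k\oplus\mathfrak h$ (direct sum of vector spaces) with $\mathfrak h$ an ideal, the associated data are: $[\cdot,\cdot]_{\mathfrak h}$ is the restriction of the bracket to $\mathfrak h$; $[\cdot,\cdot]_{\mathfrak k}$ is the Lie bracket on $\mathfrak k$ transported from $\mathfrak g/\mathfrak h$ by the linear isomorphism $\mathfrak k\to\mathfrak g/\mathfrak h$ (equivalently, the $\mathfrak k$-component of the bracket of $\mathfrak g$); $\alpha:\mathfrak k\times\mathfrak k\to\mathfrak h$ is the $\mathfrak h$-component of the bracket, so $[x,y]=[x,y]_{\mathfrak k}+\alpha(x,y)$ for $x,y\in\mathfrak k$; and $\pi(x)y=[x,y]$ for $x\in\mathfrak k$, $y\in\mathfrak h$. *)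

(* Defs.v *)
From HB Require Import structures.
From mathcomp Require Import all_boot all_order all_algebra.

Set Implicit Arguments.
Unset Strict Implicit.
Unset Printing Implicit Defensive.

Import GRing.Theory.
Local Open Scope ring_scope.

HB.mixin Record Lmodule_isLieAlgebra (F : fieldType) L of GRing.Lmodule F L := {
  lie : L -> L -> L;
  lie_linearl : forall y, linear (lie^~ y);
  lie_linearr : forall x, linear (lie x);
  liexx : forall x, lie x x = 0;
  lie_jacobi : forall x y z,
    lie x (lie y z) + lie y (lie z x) + lie z (lie x y) = 0
}.

#[short(type="lieAlgType")]
HB.structure Definition LieAlgebra (F : fieldType) :=
  {L of GRing.Lmodule F L & Lmodule_isLieAlgebra F L}.

Notation "'[lie' x , y ]" := (lie x y)
  (at level 0, x, y at level 99, format "[lie  x ,  y ]") : ring_scope.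

HB.mixin Record isLieIdeal (F : fieldType) (L : lieAlgType F) (S : {pred L}) := {
  lie_idealP : forall x y : L, y \in S -> [lie x, y] \in S
}.

#[short(type="lieIdeal")]
HB.structure Definition LieIdeal (F : fieldType) (L : lieAlgType F) :=
  {S of GRing.SubmodClosed F S & isLieIdeal F L S}.

Section Subspace.
Variables (F : fieldType) (V : lmodType F).

Definition subspace (S : submodClosed V) := {x : V | x \in S}.

Variable S : submodClosed V.
HB.instance Definition _ := SubChoice.on (subspace S).
HB.instance Definition _ := [SubChoice_isSubLmodule of subspace S by <:].

End Subspace.

Section IdealLie.
Variables (F : fieldType) (g : lieAlgType F) (h : lieIdeal g).
Implicit Types x y z : subspace h.

Definition ideal_act (u : g) (y : subspace h) : subspace h :=
  Sub [lie u, val y] (lie_idealP u (val y) (valP y)).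

Definition ideal_lie x y : subspace h := ideal_act (val x) y.

Lemma ideal_lie_linearl y : linear (ideal_lie^~ y).
Proof. by move=> a u v; apply: val_inj; apply: lie_linearl. Qed.

Lemma ideal_lie_linearr x : linear (ideal_lie x).
Proof. by move=> a u v; apply: val_inj; apply: lie_linearr. Qed.

Lemma ideal_liexx x : ideal_lie x x = 0.
Proof. by apply: val_inj; apply: liexx. Qed.

Lemma ideal_lie_jacobi x y z :
  ideal_lie x (ideal_lie y z) + ideal_lie y (ideal_lie z x)
    + ideal_lie z (ideal_lie x y) = 0.
Proof. by apply: val_inj; apply: lie_jacobi. Qed.

HB.instance Definition _ := Lmodule_isLieAlgebra.Build F (subspace h)
  ideal_lie_linearl ideal_lie_linearr ideal_liexx ideal_lie_jacobi.

End IdealLie.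

Definition almost_complex_structure (F : fieldType) (V : lmodType F)
  (J : {linear V -> V}) := forall x, J (J x) = - x.

Definition complex_structure (F : fieldType) (L : lieAlgType F)
    (J : {linear L -> L}) :=
  almost_complex_structure J /\
  forall x y, [lie J x, J y] = [lie x, y] + J [lie J x, y] + J [lie x, J y].

Definition direct_sum (F : fieldType) (V : lmodType F) (k h : submodClosed V) :=
  forall v : V, exists! p : subspace k * subspace h, v = val p.1 + val p.2.

Section Projections.
Variables (F : fieldType) (V : lmodType F) (k h : submodClosed V).
Hypothesis kh : direct_sum k h.

Lemma split_ex v : exists p : subspace k * subspace h, v == val p.1 + val p.2.
Proof. by have [p [/eqP]] := kh v; exists p. Qed.

Definition proj_l v : subspace k := (xchoose (split_ex v)).1.
Definition proj_r v : subspace h := (xchoose (split_ex v)).2.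

Lemma proj_sum v : v = val (proj_l v) + val (proj_r v).
Proof. exact/eqP/(xchooseP (split_ex v)). Qed.

Lemma proj_eq v (x : subspace k) (y : subspace h) :
  v = val x + val y -> proj_l v = x /\ proj_r v = y.
Proof.
move=> vE; have [p [_ pu]] := kh v.
have := pu (proj_l v, proj_r v) (proj_sum v); rewrite (pu (x, y) vE).
by case.
Qed.

Lemma proj_linear a u v :
  proj_l (a *: u + v) = a *: proj_l u + proj_l v /\
  proj_r (a *: u + v) = a *: proj_r u + proj_r v.
Proof.
apply: proj_eq; rewrite !linearP /= {1}(proj_sum u) {1}(proj_sum v).
by rewrite scalerDr addrACA.
Qed.

Lemma proj_l_linear : linear proj_l.
Proof. by move=> a u v; have [] := proj_linear a u v. Qed.

Lemma proj_r_linear : linear proj_r.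
Proof. by move=> a u v; have [] := proj_linear a u v. Qed.

HB.instance Definition _ := GRing.isLinear.Build F V (subspace k) *:%R proj_l
  proj_l_linear.
HB.instance Definition _ := GRing.isLinear.Build F V (subspace h) *:%R proj_r
  proj_r_linear.

End Projections.

Section Extension.
Variables (F : fieldType) (g : lieAlgType F) (k : submodClosed g).
Variables (h : lieIdeal g) (kh : direct_sum k h).

(* The Lie bracket of g / h read through the isomorphism k -> g / h induced by
   the splitting: the class of v in g / h corresponds to proj_l v in k. *)
Definition ext_lie (x y : subspace k) : subspace k :=
  proj_l kh [lie val x, val y].

Definition ext_alpha (x y : subspace k) : subspace h :=
  proj_r kh [lie val x, val y].

Lemma ext_lie_alphaE (x y : subspace k) :
  [lie val x, val y] = val (ext_lie x y) + val (ext_alpha x y).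
Proof. exact: proj_sum. Qed.

Definition ext_pi (x : subspace k) (y : subspace h) : subspace h :=
  ideal_act (val x) y.

Variables (J : {linear subspace h -> subspace h}).
Variables (j : {linear subspace k -> subspace k}).
Variables (beta : {linear subspace k -> subspace h}).

Definition ext_J (v : g) : g :=
  let x := proj_l kh v in
  val (j x) + val (beta x) + val (J (proj_r kh v)).

Lemma ext_J_linear : linear ext_J.
Proof.
move=> a u v; rewrite /ext_J !linearP.
by rewrite /= !scalerDr [X in X + _ = _]addrACA [LHS]addrACA.
Qed.

HB.instance Definition _ := GRing.isLinear.Build F g g *:%R ext_J ext_J_linear.

Lemma ext_J_h (y : subspace h) : ext_J (val y) = val (J y).
Proof.
have [] := @proj_eq _ _ _ _ kh (val y) 0 y; first by rewrite linear0 add0r.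
by rewrite /ext_J => -> ->; rewrite !linear0 !add0r.
Qed.

Lemma ext_J_k (x : subspace k) : ext_J (val x) = val (j x) + val (beta x).
Proof.
have [] := @proj_eq _ _ _ _ kh (val x) x 0; first by rewrite linear0 addr0.
by rewrite /ext_J => -> ->; rewrite !linear0 addr0.
Qed.

End Extension.

(* Main.v *)
Require Import Defs.
From HB Require Import structures.
From mathcomp Require Import all_boot all_order all_algebra reals.

Set Implicit Arguments.
Unset Strict Implicit.
Unset Printing Implicit Defensive.

Import GRing.Theory.
Local Open Scope ring_scope.

(** An almost complex structure is integrable exactly when its Nijenhuis
    tensor N(u, v) = [Ju, Jv] - [u, v] - J[Ju, v] - J[u, Jv] vanishes
    ([complex_structureP]).  Since N is biadditive and antisymmetric, on a direct
    sum k + h it vanishes as soon as it does on k x k, k x h and h x h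
    ([nijenhuis_eq0_sum]).  For the extended map Jt = [ext_J kh J j beta] the
    block h x h is the Nijenhuis tensor of J, which is zero by assumption; the
    block k x h takes values in the ideal h, and its vanishing is the second
    condition; the block k x k has a component in k, whose vanishing is the third
    condition, and one in h, whose vanishing is the fourth.  Finally
    Jt (Jt x) + x = beta (j x) + J (beta x) for x in k, so that Jt squares to -1
    if and only if the first condition holds ([ext_J_almost_complexP]). *)

Section Nijenhuis.
Variables (F : fieldType) (L : lieAlgType F).
Implicit Types x y z : L.

Lemma lieDl x y z : [lie x + y, z] = [lie x, z] + [lie y, z].
Proof. by have := lie_linearl z 1 x y; rewrite !scale1r. Qed.

Lemma lieDr x y z : [lie x, y + z] = [lie x, y] + [lie x, z].
Proof. by have := lie_linearr x 1 y z; rewrite !scale1r. Qed.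

Lemma lieC x y : [lie x, y] = - [lie y, x].
Proof.
apply/eqP; rewrite -addr_eq0; apply/eqP.
by have := liexx (x + y); rewrite lieDl !lieDr !liexx add0r addr0.
Qed.

Definition nijenhuis (J : L -> L) x y : L :=
  [lie J x, J y] - [lie x, y] - J [lie J x, y] - J [lie x, J y].

Variable J : {linear L -> L}.

Lemma complex_structureP :
  complex_structure J <->
  almost_complex_structure J /\ forall x y, nijenhuis J x y = 0.
Proof.
have nE x y : nijenhuis J x y = 0 <->
    [lie J x, J y] = [lie x, y] + J [lie J x, y] + J [lie x, J y].
  rewrite /nijenhuis -!addrA -!opprD addrA.
  by split=> [/subr0_eq|->]; last exact: subrr.
by split=> -[sqJ JN]; split=> // x y; apply/nE.
Qed.

Lemma nijenhuisDl x y z :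
  nijenhuis J (x + y) z = nijenhuis J x z + nijenhuis J y z.
Proof.
rewrite /nijenhuis raddfD !lieDl !raddfD /=.
by do 3![rewrite [RHS]addrACA; congr (_ + _)].
Qed.

Lemma nijenhuisC x y : nijenhuis J x y = - nijenhuis J y x.
Proof.
rewrite /nijenhuis (lieC (J x) (J y)) (lieC x y) (lieC (J x) y) (lieC x (J y)).
by rewrite !raddfN /= !opprD !opprK addrAC.
Qed.

Lemma nijenhuisDr x y z :
  nijenhuis J x (y + z) = nijenhuis J x y + nijenhuis J x z.
Proof.
by rewrite nijenhuisC nijenhuisDl opprD -(nijenhuisC x y) -(nijenhuisC x z).
Qed.

(** Expanding N(x + y, x' + y') along the splitting gives four blocks; three
    suffice, since antisymmetry deduces the block h x k from k x h. *)
Lemma nijenhuis_eq0_sum (k h : submodClosed L) : direct_sum k h ->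
  (forall x y : subspace k, nijenhuis J (val x) (val y) = 0) ->
  (forall (x : subspace k) (y : subspace h),
     nijenhuis J (val x) (val y) = 0) ->
  (forall x y : subspace h, nijenhuis J (val x) (val y) = 0) ->
  forall u v, nijenhuis J u v = 0.
Proof.
move=> kh Nkk Nkh Nhh u v; rewrite (proj_sum kh u) (proj_sum kh v).
rewrite nijenhuisDl !nijenhuisDr Nkk Nkh Nhh.
by rewrite nijenhuisC Nkh oppr0 !addr0.
Qed.

End Nijenhuis.

Section SubspaceVal.
Variables (F : fieldType) (V : lmodType F) (S : submodClosed V).
Implicit Types x y : subspace S.

Lemma subspace_valD x y : val (x + y) = val x + val y.
Proof. exact: (raddfD (\val : subspace S -> V)). Qed.

Lemma subspace_valN x : val (- x) = - val x.
Proof. exact: (raddfN (\val : subspace S -> V)). Qed.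

End SubspaceVal.

Lemma direct_sum_eq0 {F : fieldType} {V : lmodType F} {k h : submodClosed V}
    (kh : direct_sum k h) (x : subspace k) (y : subspace h) :
  val x + val y = 0 <-> x = 0 /\ y = 0.
Proof.
split=> [xy0|[-> ->]]; last by rewrite !linear0 addr0.
have [] := proj_eq kh (esym xy0).
by rewrite !linear0 => -> ->.
Qed.

Section Extension.
Variables (F : fieldType) (g : lieAlgType F) (k : submodClosed g).
Variables (h : lieIdeal g) (kh : direct_sum k h).
Variables (J : {linear subspace h -> subspace h}).
Variables (j : {linear subspace k -> subspace k}).
Variables (beta : {linear subspace k -> subspace h}).

Notation Jt := (ext_J kh J j beta).

Lemma ext_JD u v : Jt (u + v) = Jt u + Jt v.
Proof. exact: raddfD. Qed.

Lemma ext_JN u : Jt (- u) = - Jt u.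
Proof. exact: raddfN. Qed.

Lemma ext_J_kh (x : subspace k) (y : subspace h) :
  Jt (val x + val y) = val (j x) + val (beta x + J y).
Proof. by rewrite ext_JD ext_J_k ext_J_h -addrA subspace_valD. Qed.

(** Jt has block-triangular form with diagonal blocks j and J, both of square
    -1; so Jt^2 = -1 amounts to the vanishing of the off-diagonal block
    beta o j + J o beta of Jt^2. *)
Lemma ext_J_almost_complexP :
  almost_complex_structure J -> almost_complex_structure j ->
  almost_complex_structure Jt <->
  forall x : subspace k, J (beta x) = - beta (j x).
Proof.
move=> sqJ sqj.
have JtJtE (x : subspace k) (y : subspace h) :
    Jt (Jt (val x + val y)) + (val x + val y) = val (beta (j x) + J (beta x)).
  rewrite !ext_J_kh sqj subspace_valN addrACA addNr add0r.
  have -> : J (beta x + J y) = J (beta x) - y by rewrite raddfD /= sqJ.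
  by rewrite -subspace_valD addrA addrNK.
split=> [sqJt x|bJ v].
  apply/eqP; rewrite -addr_eq0 addrC; apply/eqP/val_inj.
  by rewrite -(JtJtE x 0) sqJt addNr linear0.
apply/eqP; rewrite -addr_eq0 (proj_sum kh v) JtJtE bJ subrr.
by rewrite linear0.
Qed.

(** The inclusion of h in g respects brackets and intertwines J and Jt, hence
    carries one Nijenhuis tensor to the other. *)
Lemma nijenhuis_hh (x y : subspace h) :
  nijenhuis Jt (val x) (val y) = val (nijenhuis J x y).
Proof.
have lie_hh (z t : subspace h) : [lie val z, val t] = val [lie z, t] by [].
by rewrite /nijenhuis !ext_J_h !lie_hh !ext_J_h !(subspace_valD, subspace_valN).
Qed.

(** The difference of the two sides of the compatibility of pi with J,
    twisted by beta. *)
Definition defect_kh (x : subspace k) (y : subspace h) : subspace h :=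
  ext_pi (j x) (J y) + [lie beta x, J y] -
  (ext_pi x y + J (ext_pi (j x) y) + J (ext_pi x (J y)) + J [lie beta x, y]).

(** Every bracket in N(x, y) has an argument in the ideal h, where Jt acts as J;
    so the whole block stays in h and gives a single condition. *)
Lemma nijenhuis_kh (x : subspace k) (y : subspace h) :
  nijenhuis Jt (val x) (val y) = val (defect_kh x y).
Proof.
rewrite /nijenhuis ext_J_h ext_J_k !lieDl !ext_JD.
have actE (u : g) (z : subspace h) : [lie u, val z] = val (ideal_act u z) by [].
rewrite !actE !ext_J_h /defect_kh !opprD !(subspace_valD, subspace_valN) !addrA.
by rewrite [LHS]addrAC.
Qed.

(** The difference of the two sides of the integrability of j for the
    bracket of g / h. *)
Definition defect_kk_k (x y : subspace k) : subspace k :=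
  ext_lie kh (j x) (j y) -
  (ext_lie kh x y + j (ext_lie kh (j x) y) + j (ext_lie kh x (j y))).

(** The difference of the two sides of the equation for alpha. *)
Definition defect_kk_h (x y : subspace k) : subspace h :=
  ext_alpha kh (j x) (j y) - ext_alpha kh x y
    - J (ext_alpha kh x (j y)) - J (ext_alpha kh (j x) y) -
  (beta (ext_lie kh (j x) y) + beta (ext_lie kh x (j y))
    - [lie beta x, beta y]
    + ext_pi (j y) (beta x) - ext_pi (j x) (beta y)
    - J (ext_pi y (beta x)) + J (ext_pi x (beta y))).

(** Expanding the brackets of Jt x = j x + beta x produces pi from the mixed
    terms and splits [x, y] into its k-part and alpha x y; since Jt sends k to
    k + h through j and beta, the term beta [., .] lands in the h-component. *)
Lemma nijenhuis_kk (x y : subspace k) :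
  nijenhuis Jt (val x) (val y) = val (defect_kk_k x y) + val (defect_kk_h x y).
Proof.
have lie_kh (u : subspace k) (z : subspace h) :
  [lie val u, val z] = val (ext_pi u z) by [].
have lie_hk (u : subspace k) (z : subspace h) :
  [lie val z, val u] = val (- ext_pi u z) by rewrite lieC raddfN.
have lie_hh (z t : subspace h) : [lie val z, val t] = val [lie z, t] by [].
rewrite /nijenhuis !ext_J_k !lieDl !lieDr.
rewrite lie_hh !lie_kh !lie_hk !(ext_lie_alphaE kh).
rewrite !subspace_valN !ext_JD ext_JN !ext_J_k !ext_J_h.
rewrite /defect_kk_k /defect_kk_h !opprD !(subspace_valD, subspace_valN).
rewrite !opprK !addrA.
(* Regroup the fifteen terms of the expansion: the first four in the result
   lie in k, the others in h. *)
by rewrite [LHS](ACl (1*6*8*12*2*7*14*10*9*13*5*4*3*11*15)).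
Qed.

End Extension.

Theorem proposition3p1 (R : realType) (g : lieAlgType R)
    (k : submodClosed g) (h : lieIdeal g) (kh : direct_sum k h)
    (J : {linear subspace h -> subspace h}) (hJ : complex_structure J)
    (j : {linear subspace k -> subspace k}) (hj : almost_complex_structure j)
    (beta : {linear subspace k -> subspace h}) :
  complex_structure (ext_J kh J j beta) <->
  [/\ forall x : subspace k, J (beta x) = - beta (j x),
      forall (x : subspace k) (y : subspace h),
        ext_pi (j x) (J y) + [lie beta x, J y] =
        ext_pi x y + J (ext_pi (j x) y) + J (ext_pi x (J y))
          + J [lie beta x, y],
      forall x y : subspace k,
        ext_lie kh (j x) (j y) =
        ext_lie kh x y + j (ext_lie kh (j x) y) + j (ext_lie kh x (j y))
    & forall x y : subspace k,
        ext_alpha kh (j x) (j y) - ext_alpha kh x y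
          - J (ext_alpha kh x (j y)) - J (ext_alpha kh (j x) y) =
        beta (ext_lie kh (j x) y) + beta (ext_lie kh x (j y))
          - [lie beta x, beta y]
          + ext_pi (j y) (beta x) - ext_pi (j x) (beta y)
          - J (ext_pi y (beta x)) + J (ext_pi x (beta y))].
Proof.
have [sqJ NJ0] := (complex_structureP J).1 hJ.
have sqJtP := ext_J_almost_complexP kh beta sqJ hj.
rewrite complex_structureP; split=> [[/sqJtP c1 N0]|[c1 c2 c3 c4]].
  have Nkk x y := (direct_sum_eq0 kh _ _).1
    (etrans (esym (nijenhuis_kk kh J j beta x y)) (N0 _ _)).
  split=> // x y; apply: subr0_eq.
  - apply/val_inj; rewrite linear0.
    exact: etrans (esym (nijenhuis_kh _ _ _ _ _ _)) (N0 _ _).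
  - by have [] := Nkk x y.
  - by have [] := Nkk x y.
split; first exact/sqJtP.
apply: (nijenhuis_eq0_sum kh) => x y.
- by apply/(etrans (nijenhuis_kk _ _ _ _ _ _))/(direct_sum_eq0 kh); split;
    apply/eqP; rewrite subr_eq0; apply/eqP; [exact: c3 | exact: c4].
- apply: etrans (nijenhuis_kh _ _ _ _ _ _) _.
  by rewrite /defect_kh c2 subrr linear0.
- by apply: etrans (nijenhuis_hh _ _ _ _ _ _) _; rewrite NJ0 linear0.
Qed.
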